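(* Let $\mathbb{H}$ be the half-plane one-way lattice, i.e. the $\epsilon$-horizontally oriented lattice on $\mathbb{Z}^2$ with the deterministic sequence $\epsilon_y=1$ if $y\ge 0$ and $\epsilon_y=-1$ if $y<0$. Then the simple random walk on $\mathbb{H}$ is transient.
   Context: Given a $\{-1,1\}$-valued sequence $\epsilon=(\epsilon_y)_{y\in\mathbb{Z}}$, the $\epsilon$-horizontally oriented lattice is the directed graph with vertex set $\mathbb{Z}^2$ in which there is an oriented edge from $u=(u_1,u_2)$ to $v=(v_1,v_2)$ if and only if either $v_1=u_1$ and $v_2=u_2\pm 1$, or $v_2=u_2$ and $v_1=u_1+\epsilon_{u_2}$. Thus vertical edges can be used in both directions, each horizontal line is one-way, and every vertex has exactly $3$ outgoing edges. The simple random walk on this graph is the $\mathbb{Z}^2$-valued Markov chain $(M_n)_{n\ge 0}$ started at $M_0=(0,0)$ that at each step follows one of the $3$ outgoing edges of its current position with probability $1/3$ each. Recurrence and transience are meant in the usual sense for (irreducible) Markov chains. *)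

(* Defs.v *)
From HB Require Import structures.
From mathcomp Require Import all_boot all_order all_algebra.
From mathcomp Require Import all_classical all_reals all_analysis.

Set Implicit Arguments.
Unset Strict Implicit.
Unset Printing Implicit Defensive.

Import Order.TTheory GRing.Theory Num.Theory.

Local Open Scope classical_set_scope.
Local Open Scope ring_scope.

Definition oriented_edge (eps : int -> int) (u v : int * int) : bool :=
  (v.1 == u.1) && ((v.2 == u.2 + 1) || (v.2 == u.2 - 1))
  || (v.2 == u.2) && (v.1 == u.1 + eps u.2).

Lemma oriented_edgeE (eps : int -> int) (u v : int * int) :
  oriented_edge eps u v =
  (v \in [:: (u.1, u.2 + 1); (u.1, u.2 - 1); (u.1 + eps u.2, u.2)]).
Proof.
case: u v => u1 u2 [v1 v2]; rewrite /oriented_edge !inE !xpair_eqE /=.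
by rewrite andb_orr orbA [(v2 == u2) && _]andbC.
Qed.

Definition srw_kernel (R : realType) (eps : int -> int)
    (u v : int * int) : R :=
  if oriented_edge eps u v then 3%:R^-1 else 0.

Definition half_plane (y : int) : int := if 0 <= y then 1 else -1.

Section markov_chains.
Context {R : realType} {V : countType}.
Implicit Types (p : V -> V -> R) (x : V).

(* Equals 0 when [P B = 0], since [0^-1 = 0]; used below only for [P B != 0]. *)
Definition cond_prob {d : measure_display} {T : measurableType d}
    (P : probability T R) (A B : set T) : R :=
  fine (P (A `&` B)) / fine (P B).

Definition history {T : Type} (M : nat -> T -> V) (h : nat -> V) (n : nat) :
    set T :=
  [set w | forall i, (i <= n)%N -> M i w = h i].

(* As [V] is countable, measurability of all the fibres of [M n] is
   measurability of [M n] for the discrete sigma-algebra on [V]. *)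
Definition markov_chain p x {d : measure_display} {T : measurableType d}
    (P : probability T R) (M : nat -> T -> V) : Prop :=
  [/\ forall n y, measurable [set w | M n w = y],
      P [set w | M 0%N w = x] = 1%E
    & forall n (h : nat -> V) y, P (history M h n) != 0%E ->
        cond_prob P [set w | M n.+1 w = y] (history M h n) = p (h n) y].

(* The probability of a return to [x] depends only on [p] and [x], so it does
   not matter on which probability space the chain is realised. *)
Definition transient_state p x : Prop :=
  forall (d : measure_display) (T : measurableType d) (P : probability T R)
    (M : nat -> T -> V),
  markov_chain p x P M ->
  (P [set w | exists2 n, (0 < n)%N & M n w = x] < 1)%E.

Definition transient p : Prop := forall x, transient_state p x.

End markov_chains.

(* Main.v *)
(* A state x is transient as soon as, for every e > 0, there is a function G with
   values in a fixed interval [0, B] such that G >= PG + k 1_x - e, where k > 0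
   does not depend on e: stopping the almost supermartingale G(M_n) at the first
   return to x bounds the probability of a return by 1 - k / (2B). Such functions
   can be pulled back along edges by applying P, so the states (x, 0) suffice.

   On the half-plane lattice G is an average of plane waves. For every angle th
   with e^(i th) != 1, let r e^(i f) be the root in the unit disc of
   z + 1/z = 3 - e^(i th). Then
     w(x, y) = 3 / (1/r - r) * r^|y| * cos (f (y + 1) + th x)
   satisfies w - Pw = 1_(y = 0) cos (th x). Averaging over th = 2 pi j / N with
   0 < j < N gives F - PF = 1_(y = 0) (1_(N | x) - 1/N). As 1/r - r is at least of
   order |th|^(1/2), and |th|^(-1/2) is integrable at 0, the function F is bounded
   uniformly in N. *)
Require Import Defs.
From mathcomp Require Import all_boot all_order all_algebra.
From mathcomp Require Import all_classical all_reals all_analysis.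
From mathcomp Require Import ring lra zify.

Set Implicit Arguments.
Unset Strict Implicit.
Unset Printing Implicit Defensive.

Import Order.TTheory GRing.Theory Num.Theory.
Import numFieldNormedType.Exports.

Local Open Scope classical_set_scope.
Local Open Scope ring_scope.

(** * Potentials and averaging over the out-neighbours *)

Section potential.
Context {R : realType} {V : countType} (p : V -> V -> R) (nbr : V -> seq V).
Hypothesis nbr_uniq : forall u, uniq (nbr u).
Hypothesis p_ge0 : forall u v, 0 <= p u v.
Hypothesis p_sum1 : forall u, \sum_(v <- nbr u) p u v = 1.

Definition step_mean (G : V -> R) (u : V) : R := \sum_(v <- nbr u) p u v * G v.

Definition has_potential (x : V) : Prop :=
  exists2 B : R, 0 < B & exists2 k : R, 0 < k & forall e : R, 0 < e ->
    exists2 G : V -> R, forall u, 0 <= G u <= B &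
      forall u, step_mean G u + k * (u == x)%:R - e <= G u.

Lemma step_mean_le (F G : V -> R) u :
  (forall v, F v <= G v) -> step_mean F u <= step_mean G u.
Proof. by move=> FG; apply: ler_sum => v _; apply: ler_wpM2l. Qed.

Lemma step_mean_cst (c : R) u : step_mean (fun=> c) u = c.
Proof. by rewrite /step_mean -mulr_suml p_sum1 mul1r. Qed.

Lemma step_meanD (F G : V -> R) u :
  step_mean (fun v => F v + G v) u = step_mean F u + step_mean G u.
Proof. by rewrite -big_split; apply: eq_bigr => v _; rewrite mulrDr. Qed.

Lemma step_meanZ (c : R) (G : V -> R) u :
  step_mean (fun v => c * G v) u = c * step_mean G u.
Proof. by rewrite mulr_sumr; apply: eq_bigr => v _; rewrite mulrCA. Qed.

(** Averaging is monotone and fixes constants, so averaging the inequality for [G] gives one for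
    [step_mean G]. At [x] the averaged indicator of [y] is at least [p x y], whence the new constant
    [k * p x y]. *)
Lemma has_potential_step x y :
  y \in nbr x -> 0 < p x y -> has_potential y -> has_potential x.
Proof.
move=> xy pxy [B B0 [k k0 pot]]; exists B => //.
exists (k * p x y); first exact: mulr_gt0.
move=> e e0; have [G GB Gk] := pot e e0.
exists (step_mean G) => [u|u].
  rewrite -{1}(step_mean_cst 0 u) -{1}(step_mean_cst B u).
  by rewrite !step_mean_le// => v; case/andP: (GB v).
apply: le_trans (step_mean_le u Gk).
rewrite !step_meanD step_mean_cst step_meanZ lerD2r lerD2l -mulrA ler_pM2l//.
case: eqVneq => [->|_]; last first.
  by rewrite mulr0; apply: sumr_ge0 => v _; rewrite mulr_ge0.
rewrite /step_mean (bigD1_seq y)//= eqxx mulr1 lerDl.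
by apply: sumr_ge0 => v _; rewrite mulr_ge0.
Qed.

(** * Histories of the chain and optional stopping *)

Section chain.
Context {d : measure_display} {T : measurableType d} (P : probability T R).
Variables (x : V) (M : nat -> T -> V).
Hypothesis MC : markov_chain p x P M.

Local Notation Pr A := (fine (P A)).

Let mM n y : measurable [set w | M n w = y].
Proof. by case: MC. Qed.

Let mMs n (s : seq V) : measurable [set w | M n w \in s].
Proof.
elim: s => [|y s IH].
  by rewrite (_ : [set w | _] = set0)//; apply/seteqP; split.
rewrite (_ : [set w | _] = [set w | M n w = y] `|` [set w | M n w \in s]).
  exact: measurableU.
apply/seteqP; split => w /=; rewrite inE; first by case/predU1P; [left|right].
by move=> ?; apply/predU1P.
Qed.

Let mH h n : measurable (history M h n).
Proof.
rewrite [X in measurable X](_ : _ =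
  \bigcap_(i in [set i | (i <= n)%N]) [set w | M i w = h i]); last by [].
by apply: bigcap_measurable; [exists 0%N|move=> i _; exact: mM].
Qed.

Lemma PrD A B : measurable A -> measurable B -> A `&` B = set0 ->
  Pr (A `|` B) = Pr A + Pr B.
Proof.
move=> mA mB AB; rewrite measureU// fineD//; exact: fin_num_measure.
Qed.

Lemma le_Pr A B : measurable A -> measurable B -> A `<=` B -> Pr A <= Pr B.
Proof.
by move=> mA mB AB; rewrite fine_le ?fin_num_measure// le_measure ?inE.
Qed.

Lemma Pr_ge0 A : 0 <= Pr A. Proof. exact: fine_ge0. Qed.

Lemma Pr_seq A n (s : seq V) : measurable A -> uniq s ->
  Pr (A `&` [set w | M n w \in s]) = \sum_(v <- s) Pr (A `&` [set w | M n w = v]).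
Proof.
move=> mA; elim: s => [_|v s IH /= /andP[vs us]].
  rewrite big_nil [X in P X](_ : _ = set0) ?measure0//.
  by apply/seteqP; split => [w []|].
rewrite big_cons -IH// -PrD.
- congr (Pr _); rewrite -setIUr; congr (_ `&` _).
  apply/seteqP; split => w /=; rewrite inE; first by case/predU1P; [left|right].
  by move=> ?; apply/predU1P.
- exact: measurableI.
- exact: measurableI.
- apply/seteqP; split => [w [[_ /= Mv] [_ /= Ms]]|//].
  by move: vs; rewrite -Mv Ms.
Qed.

Definition extend (h : nat -> V) n v i := if i == n.+1 then v else h i.

Lemma history_extend h n v :
  history M (extend h n v) n.+1 = history M h n `&` [set w | M n.+1 w = v].
Proof.
rewrite /history /extend; apply/seteqP; split => [w /= H|w /= [H Hv] i].
  split=> [i ilen|]; last by rewrite H// eqxx.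
  by rewrite H 1?ltnW// ifN// neq_ltn ltnS ilen.
by case: eqVneq => [->//|ne]; rewrite leq_eqVlt (negPf ne)/= ltnS; exact: H.
Qed.

(** The Markov property covers histories of positive probability; for a null history both sides
    vanish by monotonicity. *)
Lemma Pr_history_extend h n v :
  Pr (history M (extend h n v) n.+1) = Pr (history M h n) * p (h n) v.
Proof.
rewrite history_extend.
have [H0|H0] := eqVneq (Pr (history M h n)) 0.
  rewrite H0 mul0r; apply/eqP; rewrite eq_le Pr_ge0 andbT -H0.
  by apply: le_Pr => //; apply: measurableI => //; exact: mM.
have [_ _ /(_ n h v)] := MC.
rewrite /cond_prob setIC => <-; first by rewrite mulrC divfK.
by apply: contra_neq H0 => ->.
Qed.

Definition visit m n := [set w | exists2 j, (n < j <= n + m)%N & M j w = x].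

Lemma measurable_visit m n : measurable (visit m n).
Proof.
rewrite [X in measurable X](_ : _ =
  \bigcup_(j in [set j | (n < j <= n + m)%N]) [set w | M j w = x]).
  by apply: bigcup_measurable => y _; exact: mM.
by apply/seteqP; split => w [j nj Mj]; exists j.
Qed.

(** The transition probabilities over [nbr (h n)] sum to 1, so the event that the next state lies
    outside this list is null and only the listed states contribute. *)
Lemma Pr_visit_step m n h :
  Pr (history M h n `&` visit m n) =
  \sum_(v <- nbr (h n)) Pr (history M (extend h n v) n.+1 `&` visit m n).
Proof.
set H := history M h n; set S := [set w | M n.+1 w \in nbr (h n)].
have mS : measurable S by exact: mMs.
have mV := measurable_visit m n.
have mHn : measurable H by exact: mH.
have H0 : Pr (H `\` S) = 0.
  have : Pr H = Pr (H `&` S) + Pr (H `\` S).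
    rewrite -PrD; first by rewrite setUIDK.
    - exact: measurableI.
    - exact: measurableD.
    - by rewrite setDE setIACA setICr setI0.
  rewrite Pr_seq//.
  under eq_bigr do rewrite -history_extend Pr_history_extend.
  by rewrite -mulr_sumr p_sum1; lra.
under eq_bigr do rewrite history_extend setIAC.
rewrite -Pr_seq//; last exact: measurableI.
have -> : Pr (H `&` visit m n) =
    Pr (H `&` visit m n `&` S) + Pr ((H `&` visit m n) `\` S).
  rewrite -PrD; first by rewrite setUIDK.
  - by do 2?apply: measurableI.
  - by apply: measurableD => //; exact: measurableI.
  - by rewrite setDE setIACA setICr setI0.
rewrite [X in _ + X = _](_ : _ = 0) ?addr0//.
apply/eqP; rewrite eq_le Pr_ge0 andbT -H0; apply: le_Pr.
- by apply: measurableD => //; exact: measurableI.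
- exact: measurableD.
- by move=> w [[]].
Qed.

(* Optional stopping of the almost supermartingale [G (M n)] at the next
   visit to [x]. *)
Lemma Pr_visit_le (G : V -> R) (e : R) m n h : 0 <= e ->
  (forall u, 0 <= G u) -> (forall u, step_mean G u - e <= G u) ->
  Pr (history M h n `&` visit m n) * G x <=
  Pr (history M h n) * (step_mean G (h n) + m%:R * e).
Proof.
move=> e0 G0 Ge; elim: m n h => [|m IH] n h.
  rewrite [X in P X](_ : _ = set0).
    rewrite measure0 mul0r mul0r addr0 mulr_ge0 ?Pr_ge0//.
    by apply: sumr_ge0 => v _; rewrite mulr_ge0.
  apply/seteqP; split => [w [_ [j /= jn _]]|//].
  by move: jn; rewrite addn0 ltnNge andNb.
rewrite Pr_visit_step mulr_suml.
have -> : Pr (history M h n) * (step_mean G (h n) + m.+1%:R * e) =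
   \sum_(v <- nbr (h n)) Pr (history M (extend h n v) n.+1) * (G v + m.+1%:R * e).
  rewrite -{1}(step_mean_cst (m.+1%:R * e) (h n)) -step_meanD mulr_sumr.
  by apply: eq_bigr => v _; rewrite Pr_history_extend -mulrA.
apply: ler_sum => v _; have mV := measurable_visit m.+1 n.
(* If the next state is [x], the visit has happened and [G x] is already the value of [G] there. *)
have [->|vx] := eqVneq v x.
  apply: ler_pM; rewrite ?Pr_ge0 ?G0//; last by rewrite lerDl mulr_ge0.
  by apply: le_Pr => //; exact: measurableI.
(* Otherwise time n + 1 is no visit: the window from n + 1 to n + m + 1 loses its first time, and
   induction applies to the extended history. *)
apply: (@le_trans _ _
  (Pr (history M (extend h n v) n.+1 `&` visit m n.+1) * G x)).
  apply: ler_wpM2r => //; apply: le_Pr.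
  - exact: measurableI.
  - apply: measurableI => //; exact: measurable_visit.
  - move=> w [Hw [j jn Mj]]; split => //; exists j => //.
    have /(_ (leqnn _)) := Hw n.+1; rewrite /extend eqxx => Mn.
    have : j != n.+1 by apply: contra_neq vx => jE; rewrite -Mn -jE.
    lia.
apply: le_trans (IH _ _) _; apply: ler_wpM2l; first exact: Pr_ge0.
rewrite /extend eqxx; have := Ge v; rewrite -(natr1 m); lra.
Qed.

(** Over a horizon of m steps the total error is (m + 1) e. Since e may be chosen after m, the bound
    on the visit probability is uniform in m and passes to the limit by continuity from below. *)
Lemma Pr_return_lt1 : has_potential x ->
  (P [set w | exists2 n, (0 < n)%N & M n w = x] < 1)%E.
Proof.
move=> [B B0 [k k0 pot]].
have le m : Pr (visit m 0) <= 1 - k / (2 * B).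
  (* This choice makes (m + 1) e = k / 2, so half of the gain [k] at [x] survives. *)
  have e0 : 0 < k / (2 * m.+1%:R) by rewrite divr_gt0// mulr_gt0.
  have [G GB Gk] := pot _ e0; set e := k / _ in e0 Gk.
  have mV := measurable_visit m 0.
  have [_ P0 _] := MC; set H := history M (fun=> x) 0.
  have PH : Pr H = 1.
    rewrite (_ : H = [set w | M 0%N w = x]) ?P0//.
    by apply/seteqP; split => [w /(_ 0%N)|w Mw [|i]]//; exact.
  have mHx : measurable H by exact: mH.
  have PHc : Pr (~` H) = 0.
    have : Pr (H `|` ~` H) = Pr H + Pr (~` H).
      by apply: PrD; rewrite ?setICr//; exact: measurableC.
    rewrite setUCr probability_setT PH /=; lra.
  (* The chain starts at [x] only almost surely, so the null complement of [H] is discarded. *)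
  have VH : Pr (visit m 0) <= Pr (H `&` visit m 0).
    rewrite -[leRHS]addr0 -PHc -PrD; last by rewrite setIAC setICr set0I.
    - apply: le_Pr => //.
        by apply: measurableU; [exact: measurableI|exact: measurableC].
      by move=> w Vw; have [Hw|Hw] := pselect (H w); [left|right].
    - exact: measurableI.
    - exact: measurableC.
  have G0 u : 0 <= G u by case/andP: (GB u).
  have Ge u : step_mean G u - e <= G u.
    apply: le_trans (Gk u); rewrite lerD2r lerDl mulr_ge0// ltW//.
  have := Pr_visit_le m 0 (fun=> x) (ltW e0) G0 Ge; rewrite -/H PH mul1r => le1.
  have V1 : Pr (visit m 0) <= 1.
    by rewrite -lee_fin fineK ?fin_num_measure// probability_le1.
  have := Gk x; rewrite eqxx mulr1 => lek.
  have me : m%:R * e + e = k / 2.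
    rewrite -{2}[e]mul1r -mulrDl natr1 /e; field.
    by rewrite ?nat1r ?natr1 pnatr_eq0.
  (* The potential inequality at [x] bounds the mean of [G] after one step by G x - k + e. *)
  have le2 : Pr (visit m 0) * G x <= G x - k / 2.
    apply: le_trans (ler_wpM2r (G0 x) VH) _; apply: le_trans le1 _; lra.
  have le3 : k / 2 <= (1 - Pr (visit m 0)) * B.
    have := ler_wpM2l (_ : 0 <= 1 - Pr (visit m 0)) (proj2 (andP (GB x))).
    rewrite subr_ge0 => /(_ V1); lra.
  rewrite lerBrDl -lerBrDr -ler_pdivrMr// in le3 *.
  by rewrite invfM mulrA.
have -> : [set w | exists2 n, (0 < n)%N & M n w = x] = \bigcup_m visit m 0.
  apply/seteqP; split => [w [n n0 Mn]|w [m _ [j jm Mj]]].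
    by exists n => //; exists n => //; rewrite n0 leqnn.
  by exists j => //; case/andP: jm.
have cv : (P (visit m 0) @[m --> \oo] --> P (\bigcup_m visit m 0))%E.
  apply: nondecreasing_cvg_mu.
  - by move=> m; exact: measurable_visit.
  - by apply: bigcupT_measurable => m; exact: measurable_visit.
  - move=> m n mn; apply/subsetPset => w [j jm Mj]; exists j => //; lia.
apply: (@le_lt_trans _ _ (1 - k / (2 * B))%:E); last first.
  by rewrite lte_fin ltrBlDr ltrDl divr_gt0// mulr_gt0.
rewrite -(cvg_lim _ cv)//; apply: lime_le; first by apply/cvg_ex; eexists; exact: cv.
apply: nearW => m; rewrite -[leLHS]fineK ?lee_fin//.
by apply: fin_num_measure; exact: measurable_visit.
Qed.

End chain.

Lemma transient_state_potential x : has_potential x -> transient_state p x.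
Proof. by move=> px d T P M MC; exact: Pr_return_lt1 MC px. Qed.

End potential.

(** * A sine bound and finite sums *)

Section waves.
Context {R : realType}.
Implicit Types (a al : R) (x y m : int) (N : nat).

(** Concavity: if the bound failed at z, the mean slope on [0, z] would be below 1/2, hence also the
    slope on [z, pi/2]. Then sin (pi/2) < pi/4 < 1, a contradiction. *)
Lemma sin_ge_half (z : R) : 0 <= z <= pi / 2 -> z / 2 <= sin z.
Proof.
move=> /andP[z0 zpi]; rewrite leNgt; apply/negP => lt.
have cts (b c : R) : {within `[b, c], continuous sin}.
  by apply: continuous_subspaceT => w; exact: continuous_sin.
have drv (b c w : R) : w \in `]b, c[ -> is_derive w 1 sin (cos w).
  by move=> _; exact: is_derive_sin.
have z_gt0 : 0 < z.
  by rewrite lt_neqAle z0 andbT; apply: contraTneq lt => <-; rewrite mul0r sin0 ltxx.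
have [c1] := MVT z_gt0 (drv 0 z) (cts 0 z).
rewrite in_itv/= sin0 !subr0 => /andP[c10 c1z] E1.
have c1lt : cos c1 < 1 / 2.
  by rewrite -(ltr_pM2r z_gt0) -E1; lra.
have := pihalf_02 R; set h := pi / 2 in zpi * => /andP[h0 h2].
have [c2 + E2] := MVT_segment zpi (drv z h) (cts z h).
rewrite in_itv/= => /andP[zc2 c2h].
have c21 : cos c2 < cos c1.
  have := pi_ge2 R; rewrite /h in c2h h2 => pi2.
  by rewrite ltr_cos ?in_itv/=; [lra..].
rewrite sin_pihalf in E2.
have : cos c2 * (h - z) <= 1 / 2 * (h - z) by apply: ler_wpM2r; lra.
lra.
Qed.

(** Discrete form of the integrability of u^(-1/2) at 0: each term 1/sqrt(N+1) is at most 2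
    (sqrt(N+1) - sqrt N), and these telescope. *)
Lemma sum_inv_sqrt N :
  \sum_(1 <= j < N.+1) (Num.sqrt j%:R)^-1 <= 2 * Num.sqrt N%:R :> R.
Proof.
elim: N => [|N IH]; first by rewrite big_geq// sqrtr0 mulr0.
rewrite big_nat_recr//=; apply: le_trans (lerD IH (lexx _)) _.
have sN : Num.sqrt N%:R ^+ 2 = N%:R :> R by rewrite sqr_sqrtr.
have sN1 : Num.sqrt N.+1%:R ^+ 2 = N%:R + 1 :> R by rewrite sqr_sqrtr// natr1.
have s0 : 0 <= Num.sqrt N%:R :> R by exact: sqrtr_ge0.
have s10 : 0 < Num.sqrt N.+1%:R :> R by rewrite sqrtr_gt0.
set s := Num.sqrt N%:R in sN s0 *; set t := Num.sqrt _ in sN1 s10 *.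
rewrite -lerBrDl -div1r ler_pdivrMr//.
have := sqr_ge0 (t - s); nra.
Qed.

(** Rotation by [al] permutes the points of angle [j * al], so it fixes their vector sum (S, S').
    Either this sum is zero, or the rotation is trivial and every cosine is 1. *)
Lemma sum_cos_ge0 N al : cos (N%:R * al) = 1 ->
  0 <= \sum_(0 <= j < N) cos (j%:R * al).
Proof.
move=> cN; have sN : sin (N%:R * al) = 0.
  by apply/eqP; rewrite -norm_cos_eq1 cN normr1.
set S := \sum_(_ <= _ < _) _; set S' := \sum_(0 <= j < N) sin (j%:R * al).
have shift (f : R -> R) : f (N%:R * al) = f 0 ->
    \sum_(0 <= j < N) f (j.+1%:R * al) = \sum_(0 <= j < N) f (j%:R * al).
  move=> fN; have := @big_nat_recr _ 0 +%R N 0 (fun j => f (j%:R * al)) (leq0n _).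
  rewrite big_nat_recl// mul0r fN /= addrC => /addIr <-//.
have eC : S = S * cos al - S' * sin al.
  rewrite /S -{1}(shift cos) ?cN ?cos0// !mulr_suml -sumrB.
  by apply: eq_bigr => j _; rewrite -natr1 mulrDl mul1r cosD.
have eS : S' = S * sin al + S' * cos al.
  rewrite /S' -{1}(shift sin) ?sN ?sin0// !mulr_suml -big_split/=.
  by apply: eq_bigr => j _; rewrite -natr1 mulrDl mul1r sinD addrC.
(* The second factor is the determinant of the identity minus the rotation. *)
have : S * ((1 - cos al) ^+ 2 + sin al ^+ 2) = 0.
  transitivity ((S * (1 - cos al) + S' * sin al) * (1 - cos al)
    - (S' * (1 - cos al) - S * sin al) * sin al); first by ring.
  have -> : S * (1 - cos al) + S' * sin al = 0 by lra.
  have -> : S' * (1 - cos al) - S * sin al = 0 by lra.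
  by rewrite !mul0r subr0.
move/eqP; rewrite mulf_eq0 => /orP[/eqP->//|].
rewrite paddr_eq0 ?sqr_ge0// !sqrf_eq0 subr_eq0 => /andP[/eqP c1 /eqP s0].
apply: sumr_ge0 => j _; suff -> : cos (j%:R * al) = 1 by [].
elim: j => [|j IH]; first by rewrite mul0r cos0.
by rewrite -natr1 mulrDl mul1r cosD s0 mulr0 subr0 -c1 mulr1.
Qed.

Lemma cos_2pi_int m : cos (pi *+ 2 * m%:~R) = 1 :> R.
Proof.
have cosn n : cos (pi *+ 2 * n%:R) = 1 :> R.
  by have := periodicn (@cosD2pi R) n 0; rewrite add0r cos0 mulr_natr.
by case: m => n; rewrite ?NegzE ?mulrNz ?mulrN ?cosN; exact: cosn.
Qed.

(** * Plane waves decaying away from the axis *)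

Lemma polar_angle (c s : R) : c ^+ 2 + s ^+ 2 = 1 ->
  exists2 f, cos f = c & sin f = s.
Proof.
move=> cs; have c1 : -1 <= c <= 1.
  rewrite -ler_norml -(@ler_pXn2r _ 2)// ?nnegrE// expr1n.
  by rewrite real_normK ?num_real// -cs lerDl sqr_ge0.
have sq : Num.sqrt (1 - c ^+ 2) = `|s| by rewrite -cs addrC addKr sqrtr_sqr.
have [s0|s0] := leP 0 s.
  by exists (acos c); rewrite ?acosK ?in_itv// sin_acos// sq ger0_norm.
exists (- acos c); first by rewrite cosN acosK// in_itv.
by rewrite sinN sin_acos// sq ltr0_norm// opprK.
Qed.

(* [r e^(i f)] solves [z + 1/z = 3 - e^(2ia)]; [t = 1/r - r] and [s = sin a] are
   related by [t^4 = 12 s^2 t^2 + 16 s^2 (1 - s^2)]. *)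
Lemma decaying_root a : 0 < sin a -> exists r f : R,
  [/\ 0 < r, r <= 1, 2 * Num.sqrt (sin a) <= r^-1 - r,
      (r^-1 + r) * cos f = 3 - cos (a *+ 2) & (r^-1 - r) * sin f = sin (a *+ 2)].
Proof.
move=> s0; rewrite cos_mulr2n sin_mulr2n; set s := sin a in s0 *; set c := cos a.
have cs : c ^+ 2 = 1 - s ^+ 2 by exact: cos2sin2.
(* The quartic is quadratic in t^2 with discriminant 16 s^2 (5 s^2 + 4); [t] below is the square
   root of its positive solution. *)
pose w := Num.sqrt (5 * s ^+ 2 + 4).
have w2 : w ^+ 2 = 5 * s ^+ 2 + 4 by rewrite sqr_sqrtr//; nra.
have w_ge2 : 2 <= w.
  rewrite -(@ler_pXn2r _ 2)// ?nnegrE ?sqrtr_ge0// w2; nra.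
pose t := Num.sqrt (6 * s ^+ 2 + 2 * s * w).
have t2 : t ^+ 2 = 6 * s ^+ 2 + 2 * s * w by rewrite sqr_sqrtr//; nra.
have t0 : 0 < t by rewrite sqrtr_gt0; nra.
(* [q] is 1/r + r, since (1/r + r)^2 = (1/r - r)^2 + 4. *)
pose q := Num.sqrt (t ^+ 2 + 4).
have q2 : q ^+ 2 = t ^+ 2 + 4 by rewrite sqr_sqrtr//; nra.
have qt : t < q.
  rewrite -(@ltr_pXn2r _ 2)// ?nnegrE ?sqrtr_ge0 ?ltW// q2; lra.
pose r := (q - t) / 2.
have r0 : 0 < r by rewrite /r; lra.
have rV : r^-1 = (q + t) / 2.
  apply: (mulfI (lt0r_neq0 r0)); rewrite divff ?lt0r_neq0// /r.
  nra.
have rVD : r^-1 + r = q by rewrite rV /r; field.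
have rVB : r^-1 - r = t by rewrite rV /r; field.
have quartic : t ^+ 4 = 12 * s ^+ 2 * t ^+ 2 + 16 * s ^+ 2 * (1 - s ^+ 2).
  have -> : t ^+ 4 = (t ^+ 2) ^+ 2 by rewrite -exprM.
  rewrite t2.
  transitivity (36 * s ^+ 4 + 24 * s ^+ 3 * w + 4 * s ^+ 2 * w ^+ 2); first by ring.
  by rewrite w2; ring.
have q0 : q != 0 by rewrite lt0r_neq0// (lt_trans t0).
have tn0 : t != 0 by rewrite lt0r_neq0.
(* The required equations force these values; the quartic says exactly that their squares sum to
   1. *)
have [f cf sf] : exists2 f, cos f = (2 + 2 * s ^+ 2) / q & sin f = 2 * s * c / t.
  apply: polar_angle; rewrite !exprMn !exprVn cs q2.
  have t40 : t ^+ 2 + 4 != 0 by rewrite -q2 expf_neq0.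
  have t20 : t ^+ 2 != 0 by rewrite expf_neq0.
  rewrite addf_div// [X in X / _](_ : _ = (t ^+ 2 + 4) * t ^+ 2); last by lra.
  by rewrite divff// mulf_neq0.
exists r, f; rewrite rVD rVB cf sf; split => //.
- rewrite -(@ler_pXn2r _ 2)// ?nnegrE// ?(ltW r0)//.
  have : r * r^-1 = 1 by rewrite divff// lt0r_neq0.
  nra.
- rewrite -(@ler_pXn2r _ 2)// ?nnegrE ?mulr_ge0 ?sqrtr_ge0 ?(ltW t0)//.
  by rewrite exprMn sqr_sqrtr ?(ltW s0)// t2; nra.
- rewrite mulrC divfK//; lra.
- by rewrite mulrC divfK// -mulr_natl; ring.
Qed.

Lemma wave_exists a : 0 < sin a -> exists2 w : int -> int -> R,
  forall x y, `|w x y| <= 3 / 2 / Num.sqrt (sin a) &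
  forall x y, w x y =
    3^-1 * (w x (y + 1) + w x (y - 1) + w (x + half_plane y) y)
    + (y == 0)%:R * cos (a *+ 2 * x%:~R).
Proof.
move=> s0; have [r [f [r0 r1 le_t cf sf]]] := decaying_root s0.
move: (a *+ 2) cf sf => th cf sf; set t := r^-1 - r in le_t sf *.
have sq0 : 0 < Num.sqrt (sin a) by rewrite sqrtr_gt0.
have t0 : 0 < t by apply: lt_le_trans le_t; rewrite mulr_gt0.
(* With z = r e^(i f), this is the real part of e^(i b) (z + 1/z + e^(i th)) = 3 e^(i b). [down]
   uses the conjugate equation, since for y < 0 both the decay and the horizontal edges are
   reversed. *)
have up b : r * cos (b + f) + r^-1 * cos (b - f) + cos (b + th) = 3 * cos b.
  rewrite !cosB !cosD.
  transitivity (cos b * ((r^-1 + r) * cos f) + sin b * (t * sin f)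
    + (cos b * cos th - sin b * sin th)); first by rewrite /t; ring.
  by rewrite cf sf; ring.
have down b : r^-1 * cos (b + f) + r * cos (b - f) + cos (b - th) = 3 * cos b.
  rewrite !cosB !cosD.
  transitivity (cos b * ((r^-1 + r) * cos f) - sin b * (t * sin f)
    + (cos b * cos th + sin b * sin th)); first by rewrite /t; ring.
  by rewrite cf sf; ring.
pose al (x y : int) : R := f * (y%:~R + 1) + th * x%:~R.
exists (fun x y => 3 / t * (r ^+ absz y * cos (al x y))) => x y.
  rewrite normrM gtr0_norm ?divr_gt0// normrM.
  have -> : 3 / 2 / Num.sqrt (sin a) = 3 / (2 * Num.sqrt (sin a)).
    by rewrite invfM mulrA.
  rewrite -[leRHS]mulr1; apply: ler_pM => //; first by rewrite divr_ge0// ltW.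
    by rewrite ler_pM2l// lef_pV2// posrE mulr_gt0.
  by rewrite mulr_ile1 ?cos_max// normrX gtr0_norm// exprn_ile1// ltW.
have alU : al x (y + 1) = al x y + f by rewrite /al rmorphD/=; ring.
have alD : al x (y - 1) = al x y - f by rewrite /al rmorphB/=; ring.
have alp : al (x + 1) y = al x y + th by rewrite /al rmorphD/=; ring.
have alm : al (x - 1) y = al x y - th by rewrite /al rmorphB/=; ring.
have tn : t != 0 by rewrite lt0r_neq0.
have rn : r != 0 by rewrite lt0r_neq0.
rewrite alU alD; set b := al x y in alU alD alp alm *.
have [y0|y0|y0] := ltrgtP y 0.
- rewrite /half_plane leNgt y0 alm/= mul0r addr0.
  have [n ->] : exists n, y = - (n.+1)%:Z.
    by exists (absz y).-1; lia.
  have -> : absz (- n.+1%:Z + 1) = n by lia.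
  have -> : absz (- n.+1%:Z - 1) = n.+2 by lia.
  have -> : absz (- n.+1%:Z) = n.+1 by lia.
  transitivity (3 / t * r ^+ n.+1 * (3^-1 *
    (r^-1 * cos (b + f) + r * cos (b - f) + cos (b - th)))).
    by rewrite down; field.
  by rewrite !exprS; field; rewrite tn rn.
- rewrite /half_plane (ltW y0) /= alp mul0r addr0.
  have [n ->] : exists n, y = (n.+1)%:Z.
    by exists (absz y).-1; lia.
  have -> : absz (n.+1%:Z + 1) = n.+2 by lia.
  have -> : absz (n.+1%:Z - 1) = n by lia.
  have -> : absz (n.+1%:Z) = n.+1 by lia.
  transitivity (3 / t * r ^+ n.+1 * (3^-1 *
    (r * cos (b + f) + r^-1 * cos (b - f) + cos (b + th)))).
    by rewrite up; field.
  by rewrite !exprS; field; rewrite tn rn.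
(* On the axis the lower neighbour carries r where [up] needs 1/r. The defect is t cos (b - f), and
   the phase f (y + 1) makes b - f = th x. *)
- have -> : half_plane y = 1 by rewrite /half_plane y0 lexx.
  have -> : absz (y + 1) = 1%N by rewrite y0.
  have -> : absz (y - 1) = 1%N by rewrite y0.
  have -> : th * x%:~R = b - f by rewrite /b /al y0; ring.
  rewrite alp y0 expr0 expr1 !mul1r.
  transitivity (3 / t * (3^-1 * (r * cos (b + f) + r^-1 * cos (b - f) + cos (b + th)))).
    by rewrite up; field.
  have -> : r^-1 = t + r by rewrite /t; ring.
  by field.
Qed.

(** * Averaging the waves *)

(** For i <= N/2 the sine bound and pi >= 2 give sin (pi i/N) >= i/N; the other half follows by the
    symmetry j -> N - j. Taking the sum of both terms covers the two cases at once. *)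
Lemma inv_sqrt_sin_le N j : (0 < j < N)%N ->
  (Num.sqrt (sin (pi * j%:R / N%:R)))^-1 <=
  Num.sqrt N%:R * ((Num.sqrt j%:R)^-1 + (Num.sqrt (N - j)%:R)^-1) :> R.
Proof.
have key i : (0 < i)%N -> (i.*2 <= N)%N ->
    (Num.sqrt (sin (pi * i%:R / N%:R)))^-1 <= Num.sqrt N%:R * (Num.sqrt i%:R)^-1 :> R.
  move=> i0 iN; have N0 : 0 < N%:R :> R by rewrite ltr0n; lia.
  have i0R : 0 < i%:R :> R by rewrite ltr0n.
  have ge : i%:R / N%:R <= sin (pi * i%:R / N%:R) :> R.
    apply: le_trans (sin_ge_half _).
      by have := pi_ge2 R; have := divr_gt0 i0R N0; rewrite -mulrA; nra.
    rewrite !divr_ge0 ?mulr_ge0 ?pi_ge0//=.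
    rewrite ler_pdivrMr// -!mulrA ler_pM2l ?pi_gt0//.
    rewrite mulrC ler_pdivlMr// -natrM ler_nat; lia.
  have gt0 : 0 < i%:R / N%:R :> R by rewrite divr_gt0.
  rewrite -(sqrtrV (ler0n R i)) -sqrtrM ?ler0n// -sqrtrV; last first.
    by rewrite (le_trans (ltW gt0)).
  apply: ler_wsqrtr.
  by rewrite -[leRHS]invf_div lef_pV2 ?posrE// (lt_le_trans gt0).
move=> /andP[j0 jN].
have [le|lt] := leqP j.*2 N.
  apply: le_trans (key j j0 le) _.
  by apply: ler_wpM2l; rewrite ?sqrtr_ge0// lerDl invr_ge0 sqrtr_ge0.
have -> : sin (pi * j%:R / N%:R) = sin (pi * (N - j)%:R / N%:R) :> R.
  have N0 : N%:R != 0 :> R by rewrite pnatr_eq0; lia.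
  have -> : pi * (N - j)%:R / N%:R = - (pi * j%:R / N%:R) + pi :> R.
    by rewrite natrB 1?ltnW//; field.
  by rewrite sinDpi sinN opprK.
apply: le_trans (key (N - j)%N _ _) _; [lia|lia|].
by apply: ler_wpM2l; rewrite ?sqrtr_ge0// lerDr invr_ge0 sqrtr_ge0.
Qed.

Lemma wave_average N : (0 < N)%N -> exists2 F : int -> int -> R,
  forall x y, `|F x y| <= 6 &
  forall x y, 3^-1 * (F x (y + 1) + F x (y - 1) + F (x + half_plane y) y)
    + ((x == 0) && (y == 0))%:R - N%:R^-1 <= F x y.
Proof.
move=> N0; have NR : 0 < N%:R :> R by rewrite ltr0n.
have /choice[W HW] : forall j, exists w : int -> int -> R, (0 < j < N)%N ->
    (forall x y, `|w x y| <= 3 / 2 / Num.sqrt (sin (pi * j%:R / N%:R))) /\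
    (forall x y, w x y =
      3^-1 * (w x (y + 1) + w x (y - 1) + w (x + half_plane y) y)
      + (y == 0)%:R * cos ((pi * j%:R / N%:R) *+ 2 * x%:~R)).
  move=> j.
  (* The zero function is a mere default outside the range of summation. *)
  have [jN|_] := boolP (0 < j < N)%N; last by exists (fun _ _ => 0).
  have [|w w1 w2] := @wave_exists (pi * j%:R / N%:R); last by exists w.
  case/andP: jN => j0 jN; apply: sin_gt0_pi.
  rewrite divr_gt0 ?mulr_gt0 ?pi_gt0 ?ltr0n//= ltr_pdivrMr//.
  by rewrite ltr_pM2l ?pi_gt0// ltr_nat.
exists (fun x y => N%:R^-1 * \sum_(1 <= j < N) W j x y) => x y.
  rewrite normrM gtr0_norm ?invr_gt0// mulrC ler_pdivrMr//.
  apply: le_trans (ler_norm_sum _ _ _) _.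
  (* Each of the two sums of inverse roots is at most 2 sqrt N, so the total is at most 3/2 * 4 N =
     6 N. *)
  apply: (@le_trans _ _ (\sum_(1 <= j < N) 3 / 2 * (Num.sqrt N%:R *
     ((Num.sqrt j%:R)^-1 + (Num.sqrt (N - j)%:R)^-1)))).
    rewrite big_nat_cond [leRHS]big_nat_cond; apply: ler_sum => j.
    rewrite andbT => jN; apply: le_trans ((HW j jN).1 x y) _.
    by rewrite ler_wpM2l// inv_sqrt_sin_le.
  rewrite -!mulr_sumr big_split/=.
  have -> : \sum_(1 <= j < N) (Num.sqrt (N - j)%:R)^-1 =
    \sum_(1 <= j < N) (Num.sqrt j%:R)^-1 :> R.
    rewrite big_nat_rev/= big_nat_cond [RHS]big_nat_cond.
    by apply: eq_bigr => j; rewrite andbT => jN; congr (Num.sqrt _%:R)^-1; lia.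
  have le2 : \sum_(1 <= j < N) (Num.sqrt j%:R)^-1 <= 2 * Num.sqrt N%:R :> R.
    apply: le_trans (sum_inv_sqrt N); rewrite big_nat_recr//= lerDl.
    by rewrite invr_ge0 sqrtr_ge0.
  have sN : Num.sqrt N%:R ^+ 2 = N%:R :> R by rewrite sqr_sqrtr.
  have := ler_wpM2l (sqrtr_ge0 (N%:R : R)) le2; lra.
have -> : \sum_(1 <= j < N) W j x y =
    3^-1 * (\sum_(1 <= j < N) W j x (y + 1) + \sum_(1 <= j < N) W j x (y - 1)
            + \sum_(1 <= j < N) W j (x + half_plane y) y)
    + (y == 0)%:R * \sum_(1 <= j < N) cos (j%:R * (pi *+ 2 * x%:~R / N%:R)).
  rewrite -!big_split/= !mulr_sumr -big_split/=.
  rewrite big_nat_cond [RHS]big_nat_cond; apply: eq_bigr => j.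
  rewrite andbT => jN; rewrite {1}(HW j jN).2; congr (_ + _ * cos _).
  by ring.
set C := \sum_(1 <= j < N) cos _.
set B := \sum_(1 <= j < N) W j x (y + 1).
set B' := \sum_(1 <= j < N) W j x (y - 1).
set B'' := \sum_(1 <= j < N) W j (x + half_plane y) y.
have EC : \sum_(0 <= j < N) cos (j%:R * (pi *+ 2 * x%:~R / N%:R)) = 1 + C.
  by rewrite big_ltn// mul0r cos0.
have C0 : 0 <= 1 + C.
  rewrite -EC; apply: sum_cos_ge0.
  by rewrite mulrCA divff ?lt0r_neq0// mulr1 cos_2pi_int.
have C1 : x = 0 -> 1 + C = N%:R.
  move=> x0; rewrite -EC x0.
  under eq_bigr do rewrite mulr0 mul0r mulr0 cos0.
  by rewrite sumr_const_nat subn0.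
have -> : 3^-1 * (N%:R^-1 * B + N%:R^-1 * B' + N%:R^-1 * B'') =
    N%:R^-1 * (3^-1 * (B + B' + B'')) by ring.
rewrite [leRHS]mulrDr -[leLHS]addrA lerD2l.
have iN : 0 < N%:R^-1 :> R by rewrite invr_gt0.
(* Off the axis there is no source. On it, C = N - 1 at x = 0, and C >= -1 elsewhere, the missing
   term j = 0 being 1. *)
case: (y == 0); last by rewrite andbF /= mul0r mulr0 sub0r oppr_le0 ltW.
rewrite andbT mul1r; case: eqVneq => [/C1 e|_] /=.
  have -> : C = N%:R - 1 by rewrite -e; ring.
  by rewrite mulrBr mulVf ?lt0r_neq0// mulr1.
rewrite sub0r -mulrN1 ler_pM2l//; lra.
Qed.

End waves.

(** * The walk on the half-plane lattice *)

Section half_plane_walk.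
Context {R : realType}.

Definition out_neighbours (u : int * int) : seq (int * int) :=
  [:: (u.1, u.2 + 1); (u.1, u.2 - 1); (u.1 + half_plane u.2, u.2)].

Lemma out_neighbours_uniq u : uniq (out_neighbours u).
Proof.
rewrite /= !inE !xpair_eqE /half_plane; case: ifP => _.
all: lia.
Qed.

Lemma srw_kernelE u v :
  srw_kernel R half_plane u v = if v \in out_neighbours u then 3^-1 else 0.
Proof. by rewrite /srw_kernel oriented_edgeE. Qed.

Lemma srw_kernel_ge0 u v : 0 <= srw_kernel R half_plane u v.
Proof. by rewrite srw_kernelE; case: ifP => // _; rewrite invr_ge0. Qed.

Lemma step_mean_srw (G : int * int -> R) u :
  step_mean (srw_kernel R half_plane) out_neighbours G u =
  3^-1 * (G (u.1, u.2 + 1) + G (u.1, u.2 - 1) + G (u.1 + half_plane u.2, u.2)).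
Proof.
rewrite /step_mean big_seq (eq_bigr (fun v => 3^-1 * G v)); last first.
  by move=> v vu; rewrite srw_kernelE vu.
by rewrite -big_seq !big_cons big_nil addr0 -!mulrDr addrA.
Qed.

Lemma srw_kernel_sum1 u : \sum_(v <- out_neighbours u) srw_kernel R half_plane u v = 1.
Proof.
have := step_mean_srw (fun=> 1) u; rewrite /step_mean.
under eq_bigr do rewrite mulr1.
by move=> ->; field.
Qed.

(** The lattice is invariant under horizontal translations, so [F] may be centred at [x]; adding 6
    moves its values into [0, 12]. *)
Lemma has_potential_axis (x : int) :
  has_potential (srw_kernel R half_plane) out_neighbours (x, 0).
Proof.
exists 12 => //; exists 1 => // e e0.
pose N := (Num.bound e^-1).+1.
have Ne : N%:R^-1 <= e.
  rewrite -[leRHS]invrK lef_pV2 ?posrE ?invr_gt0// ?ltr0n//.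
  apply/ltW/(lt_le_trans (archi_boundP _)); first by rewrite invr_ge0 ltW.
  by rewrite ler_nat.
have [F F6 FE] := @wave_average R N isT.
exists (fun u => F (u.1 - x) u.2 + 6) => [[u1 u2]|[u1 u2]] /=.
  by have := F6 (u1 - x) u2; rewrite ler_norml; lra.
rewrite step_mean_srw/= mul1r xpair_eqE -(subr_eq0 u1 x).
by rewrite (addrAC u1 (half_plane u2)); have := FE (u1 - x) u2; lra.
Qed.

(** Vertical edges run both ways, so from every vertex a vertical path leads to the axis; potentials
    are pulled back along it. *)
Lemma has_potential_srw u :
  has_potential (srw_kernel R half_plane) out_neighbours u.
Proof.
have step u1 u2 v2 : v2 = u2 + 1 \/ v2 = u2 - 1 ->
    has_potential (srw_kernel R half_plane) out_neighbours (u1, v2) ->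
    has_potential (srw_kernel R half_plane) out_neighbours (u1, u2).
  move=> uv; have nb : (u1, v2) \in out_neighbours (u1, u2).
    by rewrite !inE !xpair_eqE/=; case: uv => ->; rewrite !eqxx ?orbT.
  have ge0 := srw_kernel_ge0; have sum1 := srw_kernel_sum1.
  apply: (has_potential_step out_neighbours_uniq ge0 sum1 nb).
  by rewrite srw_kernelE nb invr_gt0.
case: u => u1; elim/int_rect => [|n IH|n IH]; first exact: has_potential_axis.
- by apply: step IH; right; lia.
- by apply: step IH; left; lia.
Qed.

End half_plane_walk.

Theorem theorem1p7 (R : realType) : transient (srw_kernel R half_plane).
Proof.
move=> u; apply: (@transient_state_potential _ _ _ out_neighbours).
- exact: out_neighbours_uniq.
- exact: srw_kernel_ge0.
- exact: srw_kernel_sum1.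
- exact: has_potential_srw.
Qed.
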